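(* Let $\Sigma$ be a Label Cover instance and $\Phi_\Sigma$ the weighted system of equations constructed from $\Sigma$ as described in the context. If there are assignments $h_D:U\to D$, $h_E:V\to E$ satisfying all constraints of $\Sigma$, then $\Phi_\Sigma$ is $(1-\epsilon)$-satisfiable in $\mathscr{G}_1$, i.e., there is an assignment $X\to\mathscr{G}_1$ satisfying equations of total weight at least $1-\epsilon$.
   Context: Fix finite groups $\mathscr{G}_1,\mathscr{G}_2$ and a group homomorphism $\varphi:\mathscr{H}_1\to\mathscr{H}_2$ where $\mathscr{H}_1\leq\mathscr{G}_1$, $\mathscr{H}_2=\mathrm{Im}(\varphi)\leq\mathscr{G}_2$, and $\varphi$ extends to a homomorphism $\mathscr{G}_1\to\mathscr{G}_2$; fix $\epsilon,\delta>0$ with $1/|\mathscr{H}_2|+\delta\leq 1-\epsilon$. A Label Cover instance $\Sigma$ with disjoint finite label sets $D,E$ is a bipartite graph on $U\sqcup V$ with a map $\pi_{uv}:D\to E$ for each edge $\{u,v\}$ ($u\in U,v\in V$); assignments $h_D:U\to D,h_E:V\to E$ satisfy edge $\{u,v\}$ if $\pi_{uv}(h_D(u))=h_E(v)$. For finite $N$, $\mathscr{G}_1^N$ is the direct power with componentwise operations, and $h\mathbf{g}$ for $h\in\mathscr{H}_1$ means $(h\mathbf{g}(n))_n$. Fix a representative in each right coset $\mathscr{H}_1\mathbf{x}$ of $\mathscr{H}_1$ in $\mathscr{G}_1^E$ (and in $\mathscr{G}_1^D$), denoted $\mathbf{x}^\dagger$; for $\mathbf{a}\in\mathscr{G}_1^E$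 let $g_{\mathbf{a}}\in\mathscr{H}_1$ with $\mathbf{a}^\dagger=g_{\mathbf{a}}\mathbf{a}$. The system $\Phi_\Sigma$ has variable set $X=\{u_{\mathbf{b}}: u\in U,\mathbf{b}\in\mathscr{G}_1^D\}\sqcup\{v_{\mathbf{a}}:v\in V,\mathbf{a}\in\mathscr{G}_1^E\}$ and contains, for each edge $\{u,v\}$, $\mathbf{a}\in\mathscr{G}_1^E$, $\mathbf{b},\boldsymbol{\nu}\in\mathscr{G}_1^D$, $s_1,s_2\in\{-1,1\}$, the equation $v_{\mathbf{a}^\dagger}\,u_{\mathbf{b}^{s_1}}^{s_1}\,u_{\mathbf{c}^{s_2}}^{s_2}=g_{\mathbf{a}}$, where $\mathbf{c}=\mathbf{b}^{-1}(\mathbf{a}\circ\pi_{uv})^{-1}\boldsymbol{\nu}$ (componentwise, $(\mathbf{a}\circ\pi_{uv})(d)=\mathbf{a}(\pi_{uv}(d))$), with weight equal to the probability of the following independent choices: the edge is uniform among edges of $\Sigma$; $\mathbf{a},\mathbf{b}$ uniform in $\mathscr{G}_1^E,\mathscr{G}_1^D$; independently for each $d\in D$, $\boldsymbol{\nu}(d)=1$ with probability $1-\epsilon$ and uniform in $\mathscr{G}_1$ with probability $\epsilon$; $s_1,s_2$ uniform in $\{-1,1\}$. An assignment $f:X\to\mathscr{G}_1$ satisfies an equation $\prod=g$ if the product of the assigned values (with the exponents) equals $g$. *)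

(* Defs.v *)
From HB Require Import structures.
From mathcomp Require Import all_boot all_order all_algebra all_fingroup.

Set Implicit Arguments.
Unset Strict Implicit.
Unset Printing Implicit Defensive.

Import GroupScope GRing.Theory Num.Theory.
Local Open Scope ring_scope.

(* [dffun] (rather than [ffun]) is the alias carrying the componentwise
   finGroupType structure of gproduct.v. *)
Notation gpower gT N := {dffun forall _ : N, gT}.

(* Signs s in {-1, 1} are booleans read as (-1) ^ s, so [true] stands for -1. *)
Definition signg (gT : finGroupType) (s : bool) (x : gT) : gT :=
  if s then x^-1%g else x.

Section WeightedSystems.
Variables (R : realFieldType) (X : Type) (gT : finGroupType).

(* x_1 ^ s_1 * ... * x_k ^ s_k = g, with lhs [:: (x_1, s_1); ...; (x_k, s_k)]
   and rhs g. *)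
Record equation := Equation { eq_lhs : seq (X * bool); eq_rhs : gT }.

Definition satisfies (f : X -> gT) (e : equation) : bool :=
  (\prod_(t <- eq_lhs e) signg t.2 (f t.1))%g == eq_rhs e.

Record weighted_system := WeightedSystem {
  ws_index : finType;
  ws_eqn : ws_index -> equation;
  ws_weight : ws_index -> R }.

Definition satisfiable (c : R) (Phi : weighted_system) : Prop :=
  exists f : X -> gT,
    c <= \sum_(i : ws_index Phi | satisfies f (ws_eqn i)) ws_weight i.

End WeightedSystems.

Record label_cover (U V D E : finType) := LabelCover {
  lc_edges : {set U * V};
  lc_map : {e : U * V | e \in lc_edges} -> D -> E }.

Definition satisfies_all (U V D E : finType) (S : label_cover U V D E)
    (hD : U -> D) (hE : V -> E) : Prop :=
  forall e : {e : U * V | e \in lc_edges S},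
    lc_map e (hD (val e).1) = hE (val e).2.

Section Cosets.
Variables (gT : finGroupType) (N : finType).

Definition diagg (h : gT) : gpower gT N := [ffun _ => h].

Definition diag_coset (H : {set gT}) (x : gpower gT N) : {set gpower gT N} :=
  ((diagg @: H) :* x)%g.

Definition coset_representatives (H : {set gT})
    (rep : {set gpower gT N} -> gpower gT N) : Prop :=
  forall x : gpower gT N, rep (diag_coset H x) \in diag_coset H x.

Definition dagger (H : {set gT}) (rep : {set gpower gT N} -> gpower gT N)
    (x : gpower gT N) : gpower gT N := rep (diag_coset H x).

End Cosets.

Section Reduction.
Variables (R : realFieldType) (gT : finGroupType) (H : {set gT}).
Variables (U V D E : finType) (S : label_cover U V D E) (eps : R).
Variables (rep : {set gpower gT E} -> gpower gT E) (g : gpower gT E -> gT).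

(* [inl (u, b)] is the variable u_b and [inr (v, a)] the variable v_a. *)
Definition phi_var : Type := (U * gpower gT D + V * gpower gT E)%type.

(* Choices (edge, a, b, nu, s1, s2). *)
Definition phi_index : finType :=
  ({e : U * V | e \in lc_edges S} * gpower gT E * gpower gT D * gpower gT D
   * bool * bool)%type.

Definition phi_eqn (i : phi_index) : equation phi_var gT :=
  let: (e, a, b, nu, s1, s2) := i in
  let u := (val e).1 in
  let v := (val e).2 in
  let a_pi : gpower gT D := [ffun d => a (lc_map e d)] in
  let c : gpower gT D := (b^-1 * a_pi^-1 * nu)%g in
  Equation [:: (inr (v, dagger H rep a), false);
               (inl (u, signg s1 b), s1);
               (inl (u, signg s2 c), s2)]
           (g a).

Definition noise_prob (nu : gpower gT D) : R :=
  \prod_(d : D)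
    ((1 - eps) * (nu d == 1%g)%:R + eps * (#|[set: gT]|%:R)^-1).

Definition phi_weight (i : phi_index) : R :=
  let: (e, a, b, nu, s1, s2) := i in
  (#|lc_edges S|%:R)^-1 * (#|[set: gpower gT E]|%:R)^-1
  * (#|[set: gpower gT D]|%:R)^-1 * noise_prob nu * 2%:R^-1 * 2%:R^-1.

Definition phi_system : weighted_system R phi_var gT :=
  WeightedSystem phi_eqn phi_weight.

End Reduction.

(* Main.v *)
Require Import Defs.
From HB Require Import structures.
From mathcomp Require Import all_boot all_order all_algebra all_fingroup.
From mathcomp Require Import ring.

Import GroupScope GRing.Theory Num.Theory.
Local Open Scope ring_scope.

(** Give [u_b] the value [b (hD u)] and [v_a] the value [a (hE v)].  The exponents
    cancel against the signs in the indices, and [pi_uv (hD u) = hE v] makes every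
    left-hand side collapse to [g_a * nu (hD u)].  An equation is thus satisfied
    exactly when the noise vanishes at the single coordinate [hD u], which has
    probability [1 - eps + eps / #|G1|]. *)

Lemma sum_prodE (R : nmodType) (A B : finType) (F : A * B -> R) :
  \sum_p F p = \sum_a \sum_b F (a, b).
Proof. by rewrite pair_bigA; apply: eq_bigr => -[]. Qed.

Section DirectPower.
Variables (gT : finGroupType) (N : finType).
Implicit Types x y : gpower gT N.

Lemma gpowerM x y n : (x * y)%g n = (x n * y n)%g.
Proof. by rewrite ffunE. Qed.

Lemma gpowerV x n : (x^-1)%g n = ((x n)^-1)%g.
Proof. by rewrite ffunE. Qed.

Lemma signg_gpowerK (s : bool) x n : signg s (signg s x n) = x n.
Proof. by case: s; rewrite /= ?gpowerV ?invgK. Qed.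

End DirectPower.

Section Noise.
Variables (R : realFieldType) (gT : finGroupType) (D : finType) (eps : R).

(** The law of a single noise coordinate: [noise_prob eps nu] is the product of the
    [noise_at (nu d)]. *)
Let noise_at (x : gT) : R :=
  (1 - eps) * (x == 1%g)%:R + eps * (#|[set: gT]|%:R)^-1.

Lemma sum_noise_at : \sum_x noise_at x = 1.
Proof.
rewrite big_split /= -mulr_sumr (bigD1 1%g) //= eqxx big1 => [|x /negPf->//].
rewrite addr0 mulr1 sumr_const cardsT -[eps * _ *+ _]mulr_natr mulfVK ?subrK //.
by rewrite pnatr_eq0 -lt0n; apply/card_gt0P; exists 1%g.
Qed.

(** The coordinates are independent, so the sum factors over [D]: every coordinate other than [d]
    contributes total mass 1, and [d] contributes [noise_at 1]. *)
Lemma noise_prob_coord1 (d : D) :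
  \sum_(nu : gpower gT D | nu d == 1%g) noise_prob eps nu =
  1 - eps + eps * (#|[set: gT]|%:R)^-1.
Proof.
(* [Q] constrains coordinate [d] only; it presents the event as a [family], over which a sum of
   products becomes a product of sums. *)
pose Q (i : D) := [pred x : gT | (i == d) ==> (x == 1%g)].
have famE (nu : gpower gT D) : (nu d == 1%g) = (nu \in family Q).
  apply/idP/familyP => [nu1 i | /(_ d)]; last by rewrite inE eqxx.
  by rewrite inE; apply/implyP => /eqP->.
under eq_bigl do rewrite famE.
rewrite -(bigA_distr_big_dep Q (fun _ => noise_at)) (bigD1 d) //=.
rewrite [X in _ * X]big1 ?mulr1 => [|i /negPf i_d]; last first.
  by rewrite -[RHS]sum_noise_at; apply: eq_bigl => x; rewrite /= i_d.
by rewrite (big_pred1 1%g) => [|x]; rewrite /= ?eqxx // /noise_at eqxx mulr1.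
Qed.

End Noise.

Section DictatorAssignment.
Set Implicit Arguments.
Unset Strict Implicit.
Variables (gT : finGroupType) (H : {set gT}).
Variables (U V D E : finType) (S : label_cover U V D E).
Variables (rep : {set gpower gT E} -> gpower gT E) (g : gpower gT E -> gT).
Variables (hD : U -> D) (hE : V -> E).

(** At each vertex this is the long code of its label: a function on the direct power that reads off
    one coordinate. *)
Definition dictator (x : phi_var gT U V D E) : gT :=
  match x with
  | inl (u, b) => b (hD u)
  | inr (v, a) => a (hE v)
  end.

Hypothesis g_ok : forall a, dagger H rep a = (diagg E (g a) * a)%g.
Hypothesis S_sat : satisfies_all S hD hE.

Lemma satisfies_dictator (e : {e : U * V | e \in lc_edges S}) a b nu s1 s2 :
  satisfies dictator (phi_eqn H rep g (e, a, b, nu, s1, s2)) =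
  (nu (hD (val e).1) == 1%g).
Proof.
rewrite /satisfies /phi_eqn /= !big_cons big_nil /= mulg1 !signg_gpowerK.
(* By [S_sat] the product is [g a * a * b * b^-1 * a^-1 * nu], with [a] taken at [hE v] and [b],
   [nu] at [hD u]; each [mulgK] removes one inverse pair. *)
rewrite g_ok !gpowerM !gpowerV !ffunE S_sat !mulgA mulgK mulgK.
by rewrite -{2}[g a]mulg1 (inj_eq (mulgI _)).
Qed.

End DictatorAssignment.

Lemma phi_weight_dictator (R : realFieldType) (gT : finGroupType)
    (H : {set gT}) (U V D E : finType) (S : label_cover U V D E) (eps : R)
    (rep : {set gpower gT E} -> gpower gT E) (g : gpower gT E -> gT)
    (hD : U -> D) (hE : V -> E) :
    lc_edges S != set0 ->
    (forall a, dagger H rep a = (diagg E (g a) * a)%g) ->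
    satisfies_all S hD hE ->
  \sum_(i | satisfies (dictator hD hE) (phi_eqn H rep g i))
     @phi_weight R gT U V D E S eps i = 1 - eps + eps * (#|[set: gT]|%:R)^-1.
Proof.
move=> S_n0 g_ok S_sat; set p := RHS.
have nz (T : finGroupType) : #|[set: T]|%:R != 0 :> R.
  by rewrite pnatr_eq0 -lt0n cardG_gt0.
have S_nz : #|lc_edges S|%:R != 0 :> R by rewrite pnatr_eq0 cards_eq0.
(* [w] is the probability of one triple [(e, a, b)]; given the triple, success has probability
   [p]. *)
pose w : R := (#|lc_edges S|%:R)^-1 * (#|[set: gpower gT E]|%:R)^-1
  * (#|[set: gpower gT D]|%:R)^-1.
rewrite big_mkcond /= !sum_prodE.
transitivity (\sum_(e : {e : U * V | e \in lc_edges S})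
    \sum_(a : gpower gT E) \sum_(b : gpower gT D) w * p).
  apply: eq_bigr => e _; apply: eq_bigr => a _; apply: eq_bigr => b _.
  rewrite /p -(noise_prob_coord1 _ gT _ eps (hD (val e).1)) mulr_sumr [RHS]big_mkcond.
  apply: eq_bigr => nu _ /=.
  under eq_bigr => s1 _ do under eq_bigr => s2 _ do
    rewrite (satisfies_dictator g_ok S_sat).
  rewrite !big_bool /=; case: ifP => _; last by rewrite !addr0.
  (* The four sign pairs carry a factor 1/4 each. *)
  by rewrite -/w; field.
rewrite !sumr_const card_sig -!mulrnA -mulr_natr !natrM -!cardsT /w.
by field; rewrite !nz S_nz.
Qed.

Theorem mainTheorem4
  (R : realFieldType) (G1 G2 : finGroupType)
  (H1 : {group G1}) (phi : {morphism H1 >-> G2})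
  (phi_ext : exists psi : {morphism [set: G1] >-> G2}, {in H1, psi =1 phi})
  (eps delta : R) (eps_gt0 : 0 < eps) (delta_gt0 : 0 < delta)
  (eps_delta : (#|(phi @* H1)%g|%:R)^-1 + delta <= 1 - eps)
  (U V D E : finType) (S : label_cover U V D E)
  (S_nonempty : lc_edges S != set0)
  (repE : {set gpower G1 E} -> gpower G1 E)
  (repE_ok : coset_representatives H1 repE)
  (repD : {set gpower G1 D} -> gpower G1 D)
  (repD_ok : coset_representatives H1 repD)
  (g : gpower G1 E -> G1)
  (g_ok : forall a : gpower G1 E,
      g a \in H1 /\ dagger H1 repE a = (diagg E (g a) * a)%g)
  (S_sat : exists (hD : U -> D) (hE : V -> E), satisfies_all S hD hE) :
  satisfiable (1 - eps) (phi_system H1 S eps repE g).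
Proof.
case: S_sat => hD [hE S_sat]; exists (dictator hD hE).
have dagE a : dagger H1 repE a = (diagg E (g a) * a)%g by case: (g_ok a).
(* The surplus over [1 - eps] is [eps / #|G1|], the chance that resampled noise is trivial
   anyway. *)
rewrite phi_weight_dictator // lerDl mulr_ge0 ?invr_ge0 ?ler0n //.
exact: Order.POrderTheory.ltW.
Qed.
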